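(* Let $n\geq 2$ and let $u:[0,\infty)\to\mathbb{R}$ be the potential of a rotationally symmetric ($U(n)$ invariant) extremal Kähler metric $\omega=i\partial\overline\partial u(|z|^2)$ on $\mathbb{C}^n$, and set $g(s)=su'(s)$ for $s=|z|^2$. Then one of the following holds: (1) $\omega$ is a constant scalar curvature Kähler metric. (2) There exist constants $\beta,c$ with $\beta>0$ such that $g$ is the smooth strictly increasing function $g:(0,\infty)\to(0,\beta)$ determined by the ODE $sg'(s)=\frac{1}{\beta^2}g(s)(g(s)-\beta)^2$; integrating, $\log(g(s))-\log(\beta-g(s))-\frac{\beta}{g(s)-\beta}=\log s+c$. These metrics have positive non-constant scalar curvature. (3) There exist constants $\gamma,\beta,c$ with $\gamma<0<\beta$ such that $g$ is the smooth strictly increasing function $g:(0,\infty)\to(0,\beta)$ determined by the ODE $sg'(s)=\frac{1}{\beta\gamma}g(s)(g(s)-\beta)(g(s)-\gamma)$; integrating, $\log(g(s))+\frac{\beta\gamma}{\beta(\beta-\gamma)}\log(\beta-g(s))+\frac{\beta\gamma}{\gamma(\gamma-\beta)}\log(g(s)-\gamma)=\log s+c$. (4) There exist constants $\gamma,\beta,c$ with $0<\beta<\gamma$ such that $g$ is the smooth strictly increasing function $g:(0,\infty)\to(0,\beta)$ determined by the ODE $sg'(s)=\frac{1}{\beta\gamma}g(s)(g(s)-\beta)(g(s)-\gamma)$; integrating, $\log(g(s))+\frac{\beta\gamma}{\beta(\beta-\gamma)}\log(\beta-g(s))+\frac{\beta\gamma}{\gamma(\gamma-\beta)}\log(\gamma-g(s))=\log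 s+c$.
   Context: A rotationally symmetric Kähler metric on (a domain of) $\mathbb{C}^n$ is given by a potential $u(s)$, $s=|z|^2=\sum_j|z_j|^2$, via $\omega=i\partial\overline\partial u=i\sum_{j,k}(\delta_{jk}u'(s)+u''(s)\overline z_jz_k)\,dz^j\wedge d\overline z^k$, which is positive definite iff $u'>0$ and $u'+su''>0$. A Kähler metric is extremal (in the sense of Calabi) if its scalar curvature $R$ satisfies $R_{,\overline\alpha\overline\beta}=0$, i.e. the $(1,0)$-gradient $g^{\alpha\overline\beta}\partial R/\partial\overline z_\beta\,\partial_{z_\alpha}$ is holomorphic. *)

(* Defs.v *)
From HB Require Import structures.
From mathcomp Require Import all_boot all_order all_algebra.
From mathcomp Require Import all_classical all_reals all_analysis.
From mathcomp Require Import complex.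
Set Implicit Arguments. Unset Strict Implicit. Unset Printing Implicit Defensive.
Import Order.TTheory GRing.Theory Num.Theory.
Local Open Scope ring_scope.

Section KahlerDefs.
Variable R : realType.
Variable n : nat.

Definition pt := 'I_n -> complex R.

Definition upd (z : pt) (j : 'I_n) (w : complex R) : pt :=
  fun k => if k == j then w else z k.

Definition sq (z : pt) : R :=
  \sum_(j < n) (complex.Re (z j) ^+ 2 + complex.Im (z j) ^+ 2).

Definition pdx (j : 'I_n) (F : pt -> complex R) (z : pt) : complex R :=
  Complex
    (derive1 (fun t : R => complex.Re (F (upd z j (z j + Complex t 0)))) 0)
    (derive1 (fun t : R => complex.Im (F (upd z j (z j + Complex t 0)))) 0).
Definition pdy (j : 'I_n) (F : pt -> complex R) (z : pt) : complex R :=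
  Complex
    (derive1 (fun t : R => complex.Re (F (upd z j (z j + Complex 0 t)))) 0)
    (derive1 (fun t : R => complex.Im (F (upd z j (z j + Complex 0 t)))) 0).

Definition ii : complex R := Complex 0 1.

Definition dz (j : 'I_n) (F : pt -> complex R) (z : pt) : complex R :=
  (pdx j F z - ii * pdy j F z) / 2%:R.
Definition dzb (j : 'I_n) (F : pt -> complex R) (z : pt) : complex R :=
  (pdx j F z + ii * pdy j F z) / 2%:R.

Variable u : R -> R.

Definition metric (z : pt) : 'M[complex R]_n :=
  \matrix_(j, k)
    ((if j == k then Complex (derive1 u (sq z)) 0 else 0)
     + Complex (derive1 (derive1 u) (sq z)) 0 * conjc (z j) * z k).

(* inverse metric g^{j kbar}, characterised by sum_k g^{j kbar} g_{l kbar} = delta_{jl} *)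
Definition invmetric (z : pt) (j k : 'I_n) : complex R :=
  invmx (metric z) k j.

(* log det g (det g is real and positive for a Kaehler metric) *)
Definition logdet (z : pt) : complex R :=
  Complex (ln (complex.Re (\det (metric z)))) 0.

Definition scal (z : pt) : complex R :=
  - \sum_(j < n) \sum_(k < n) invmetric z j k * dz j (dzb k logdet) z.

Definition gradR (a : 'I_n) (z : pt) : complex R :=
  \sum_(b < n) invmetric z a b * dzb b scal z.

Definition extremal : Prop :=
  forall (a c : 'I_n) (z : pt), dzb c (gradR a) z = 0.

Definition cscK : Prop := exists c : complex R, forall z : pt, scal z = c.

End KahlerDefs.

Definition smooth_near_nonneg (R : realType) (u : R -> R) : Prop :=
  exists eps : R, 0 < eps /\
    forall (k : nat) (x : R), - eps < x -> derivable (derive1n k u) x 1.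

(* i ddbar u(|z|^2) is positive definite on all of C^n *)
Definition kahler_potential (R : realType) (u : R -> R) : Prop :=
  forall s : R, 0 <= s ->
    0 < derive1 u s /\ 0 < derive1 u s + s * derive1 (derive1 u) s.

(* Main.v *)
(** Everything is radial. With [s = |z|^2], [p = u'] and [g = s u'], the metric has eigenvalues
    [p] (with multiplicity [n - 1]) and [q = g'], so [log det] is [F(s) = (n-1) ln p + ln q], the
    scalar curvature is a function [S(s)], and its (1,0)-gradient is [(S'/g') z]. A radial multiple
    of the Euler field is holomorphic only if the factor is constant, hence [S = k g + l]. Two
    integrations turn this into [s g' = g (1 - l' g - k' g^2)] with [l' = l / (n(n+1))] and
    [k' = k / ((n+1)(n+2))]; no constants of integration appear because [g(0) = 0]. If [k = 0] the
    scalar curvature is constant. Otherwise the quadratic factor must have a positive root, since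
    [g] would blow up in finite time without one, and [g] increases below the least such root
    [beta]; the other root [gamma] is negative, equal to [beta], or larger. *)
Require Import Defs.
From HB Require Import structures.
From mathcomp Require Import all_boot all_order all_algebra.
From mathcomp Require Import all_classical all_reals all_analysis.
From mathcomp Require Import complex ring lra.
Set Implicit Arguments.
Unset Strict Implicit.
Unset Printing Implicit Defensive.
Import Order.TTheory GRing.Theory Num.Theory.
Import numFieldNormedType.Exports.
Local Open Scope ring_scope.

(** * Calculus on the real line *)

Section Calculus.
Variable R : realType.
Implicit Types (f g : R -> R) (x df dg : R).

Lemma is_derive1E f x df : is_derive x 1 f df -> derive1 f x = df.
Proof. by move=> fdf; rewrite derive1E derive_val. Qed.

Lemma derivable_is_derive1 f x : derivable f x 1 -> is_derive x 1 f (derive1 f x).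
Proof. by move=> fx; rewrite derive1E; apply: derivableP. Qed.

Lemma is_derive_addf f g x df dg : is_derive x 1 f df -> is_derive x 1 g dg ->
  is_derive x 1 (fun y => f y + g y) (df + dg).
Proof. by move=> ? ?; apply: is_deriveD. Qed.

Lemma is_derive_oppf f x df : is_derive x 1 f df ->
  is_derive x 1 (fun y => - f y) (- df).
Proof. by move=> ?; apply: is_deriveN. Qed.

Lemma is_derive_mulf f g x df dg : is_derive x 1 f df -> is_derive x 1 g dg ->
  is_derive x 1 (fun y => f y * g y) (df * g x + f x * dg).
Proof.
move=> ? ?; apply: (@is_derive_eq _ _ _ (f * g) _ _ _ (f x *: dg + g x *: df)).
by rewrite /GRing.scale/=; ring.
Qed.

Lemma is_derive_expf f n x df : is_derive x 1 f df ->
  is_derive x 1 (fun y => f y ^+ n) (n%:R * f x ^+ n.-1 * df).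
Proof.
move=> fdf.
have -> : (fun y => f y ^+ n) = f ^+ n by apply/funext => y; rewrite fctE.
exact: is_deriveX.
Qed.

Lemma is_derive_invf f x df : f x != 0 -> is_derive x 1 f df ->
  is_derive x 1 (fun y => (f y)^-1) (- df / f x ^+ 2).
Proof.
move=> fx0 fdf; apply: (is_derive_eq (is_deriveV fx0 fdf)).
by rewrite /GRing.scale/=; ring.
Qed.

Lemma is_derive_lnf f x df : 0 < f x -> is_derive x 1 f df ->
  is_derive x 1 (fun y => ln (f y)) (df / f x).
Proof.
move=> fx0 fdf; rewrite mulrC.
exact: (@is_derive1_comp R (@ln R) f x _ _ (is_derive1_ln fx0) fdf).
Qed.

Lemma is_derive_mulcf c f x df : is_derive x 1 f df ->
  is_derive x 1 (fun y => c * f y) (c * df).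
Proof.
move=> fdf; apply: (is_derive_eq (is_derive_mulf (is_derive_cst c x 1) fdf)).
by rewrite mul0r add0r.
Qed.

Lemma mean_value f (df : R -> R) (a b : R) : a < b ->
  (forall x, a <= x <= b -> is_derive x 1 f (df x)) ->
  exists2 c, a < c < b & f b - f a = df c * (b - a).
Proof.
move=> ab fdf.
have cf : {within `[a, b], continuous f}%classic.
  by apply: derivable_within_continuous => x; rewrite in_itv/= => /fdf [].
have fdf' x : x \in `]a, b[ -> is_derive x 1 f (df x).
  by move=> /subset_itv_oo_cc; rewrite in_itv/=; exact: fdf.
have [c cab E] := MVT ab fdf' cf.
by exists c.
Qed.

Lemma derive0_cst f (df : R -> R) (a b : R) : a <= b ->
  (forall x, a <= x <= b -> is_derive x 1 f (df x)) ->
  (forall x, a < x < b -> df x = 0) -> f b = f a.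
Proof.
rewrite le_eqVlt => /predU1P[->//|ab] fdf df0.
have [c /df0 dc0 /eqP] := mean_value ab fdf.
by rewrite dc0 mul0r subr_eq0 => /eqP.
Qed.

Lemma derive_le0_nonincreasing f (df : R -> R) (a b : R) : a <= b ->
  (forall x, a <= x <= b -> is_derive x 1 f (df x)) ->
  (forall x, a < x < b -> df x <= 0) -> f b <= f a.
Proof.
rewrite le_eqVlt => /predU1P[->//|ab] fdf df0.
have [c /df0 dc0 E] := mean_value ab fdf.
by rewrite -subr_le0 E mulr_le0_ge0// subr_ge0 ltW.
Qed.

Lemma derive_gt0_increasing f (df : R -> R) (a b : R) : a < b ->
  (forall x, a <= x <= b -> is_derive x 1 f (df x)) ->
  (forall x, a < x < b -> 0 < df x) -> f a < f b.
Proof.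
move=> ab fdf df0; have [c /df0 dc0 E] := mean_value ab fdf.
by rewrite -subr_gt0 E mulr_gt0// subr_gt0.
Qed.

End Calculus.

(** * Smooth functions on an open set *)

Section Smooth.
Variables (R : realType) (D : set R).
Hypothesis openD : open D.
Implicit Types f g : R -> R.

(** Records the existence of [k] successive derivatives on [D], without continuity of the last one;
    under the quantifier over all [k] in [smooth_on] the difference from class C^k disappears. *)
Fixpoint Ck (k : nat) (f : R -> R) : Prop :=
  if k is k'.+1 then (forall x, D x -> derivable f x 1) /\ Ck k' (derive1 f)
  else True.

Definition smooth_on f := forall k, Ck k f.

Let nearD x : D x -> \forall y \near x, D y.
Proof. by move=> Dx; apply: open_nbhs_nbhs; split. Qed.

(** Openness of [D] enters here: agreement on [D] is agreement near each of its points, so the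
    derivatives agree too and the induction goes on. *)
Lemma Ck_eq k f g : (forall x, D x -> f x = g x) -> Ck k f -> Ck k g.
Proof.
elim: k f g => // k IHk f g fg [df Cf].
have near_fg x : D x -> \near x, f x = g x.
  by move=> /nearD; apply: filterS => y /fg.
split=> [x Dx|]; first exact: near_eq_derivable (near_fg x Dx) (df x Dx).
apply: (IHk _ _ _ Cf) => x Dx; rewrite !derive1E.
exact: near_eq_derive (near_fg x Dx).
Qed.

(** Lets a closure property be proved by naming a formula for the derivative, to which an induction
    hypothesis applies. *)
Lemma Ck_derive k f (df : R -> R) : (forall x, D x -> is_derive x 1 f (df x)) ->
  Ck k df -> Ck k.+1 f.
Proof.
move=> fdf Cdf; split=> [x /fdf [] //|].
by apply: Ck_eq Cdf => x Dx; rewrite (is_derive1E (fdf x Dx)).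
Qed.

Lemma Ck_pred k f : Ck k.+1 f -> Ck k f.
Proof. by elim: k f => // k IHk f [df /IHk]. Qed.

Lemma Ck_is_derive k f x : Ck k.+1 f -> D x -> is_derive x 1 f (derive1 f x).
Proof. by move=> [df _] /df/derivable_is_derive1. Qed.

Lemma Ck_cst k c : Ck k (fun=> c).
Proof.
elim: k c => // k IHk c; refine (Ck_derive (df := fun=> 0) _ _) => // x _.
Qed.

Lemma Ck_add k f g : Ck k f -> Ck k g -> Ck k (fun x => f x + g x).
Proof.
elim: k f g => // k IHk f g Cf Cg.
refine (Ck_derive (df := fun x => derive1 f x + derive1 g x) _ _) => [x Dx|].
  exact: is_derive_addf (Ck_is_derive Cf Dx) (Ck_is_derive Cg Dx).
by apply: IHk; [case: Cf | case: Cg].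
Qed.

Lemma Ck_mul k f g : Ck k f -> Ck k g -> Ck k (fun x => f x * g x).
Proof.
elim: k f g => // k IHk f g Cf Cg.
refine (Ck_derive (df := fun x => derive1 f x * g x + f x * derive1 g x) _ _) => [x Dx|].
  exact: is_derive_mulf (Ck_is_derive Cf Dx) (Ck_is_derive Cg Dx).
by apply: Ck_add; apply: IHk; first [exact: Ck_pred | exact: (proj2 Cf) | exact: (proj2 Cg)].
Qed.

Lemma Ck_inv k f : (forall x, D x -> f x != 0) -> Ck k f -> Ck k (fun x => (f x)^-1).
Proof.
move=> f0; elim: k f f0 => // k IHk f f0 Cf.
(* Two copies of [(f x)^-1] instead of a square: closure under products and the induction hypothesis
   then suffice. *)
refine (Ck_derive (df := fun x => (- 1 * derive1 f x) * ((f x)^-1 * (f x)^-1)) _ _).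
  move=> x Dx; apply: (is_derive_eq (is_derive_invf (f0 x Dx) (Ck_is_derive Cf Dx))).
  by rewrite mulN1r expr2 invfM.
have Cf1 := proj2 Cf; have {}Cf := IHk f f0 (Ck_pred Cf).
by apply: Ck_mul; apply: Ck_mul => //; exact: Ck_cst.
Qed.

Lemma smooth_cst c : smooth_on (fun=> c).
Proof. by move=> k; apply: Ck_cst. Qed.

Lemma smooth_id : smooth_on (fun x => x).
Proof.
case=> // k; refine (Ck_derive (df := fun=> 1) _ (Ck_cst k 1)) => x _.
Qed.

Lemma smooth_add f g : smooth_on f -> smooth_on g -> smooth_on (fun x => f x + g x).
Proof. by move=> Sf Sg k; apply: Ck_add. Qed.

Lemma smooth_mul f g : smooth_on f -> smooth_on g -> smooth_on (fun x => f x * g x).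
Proof. by move=> Sf Sg k; apply: Ck_mul. Qed.

Lemma smooth_opp f : smooth_on f -> smooth_on (fun x => - f x).
Proof.
move=> Sf k; apply: (@Ck_eq _ (fun x => -1 * f x)) => [x _|]; first by rewrite mulN1r.
by apply: Ck_mul => //; exact: Ck_cst.
Qed.

Lemma smooth_inv f : (forall x, D x -> f x != 0) -> smooth_on f ->
  smooth_on (fun x => (f x)^-1).
Proof. by move=> f0 Sf k; apply: Ck_inv. Qed.

Lemma smooth_derive1 f : smooth_on f -> smooth_on (derive1 f).
Proof. by move=> Sf k; have [] := Sf k.+1. Qed.

Lemma smooth_is_derive f x : smooth_on f -> D x -> is_derive x 1 f (derive1 f x).
Proof. by move=> /(_ 1%N); apply: Ck_is_derive. Qed.

Lemma smooth_ln f : (forall x, D x -> 0 < f x) -> smooth_on f ->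
  smooth_on (fun x => ln (f x)).
Proof.
move=> f0 Sf [//|k]; refine (Ck_derive (df := fun x => derive1 f x / f x) _ _) => [x Dx|].
  by apply: is_derive_lnf; [exact: f0 | exact: smooth_is_derive].
apply: smooth_mul; first exact: smooth_derive1.
by apply: smooth_inv => // x Dx; rewrite gt_eqF// f0.
Qed.

End Smooth.

(** * The momentum equation *)

Section MomentumODE.
Variables (R : realType) (g q : R -> R).
Implicit Types x y s : R.
Hypothesis g0 : g 0 = 0.
Hypothesis g_derive : forall x, 0 <= x -> is_derive x 1 g (q x).
Hypothesis q_gt0 : forall x, 0 <= x -> 0 < q x.

Lemma ode_increasing x y : 0 <= x -> x < y -> g x < g y.
Proof.
move=> x0 xy; apply: (derive_gt0_increasing (df := q)) => // z /andP[xz _].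
  exact/g_derive/(le_trans x0 xz).
exact/q_gt0/(le_trans x0 (ltW xz)).
Qed.

Lemma ode_gt0 x : 0 < x -> 0 < g x.
Proof. by move=> x0; rewrite -g0 ode_increasing. Qed.

Lemma ode_mono : {in `]0, +oo[ &, {mono g : x y / x < y}}.
Proof.
move=> x y; rewrite !in_itv/= !andbT => x0 y0.
have [xy|yx|->] := ltgtP x y; last by rewrite ltxx.
- by rewrite ode_increasing// ltW.
- by apply/negbTE; rewrite -leNgt ltW// ode_increasing// ltW.
Qed.

Section Factored.
Variables A B : R.
Hypothesis ode : forall x, 0 <= x -> x * q x = g x * ((1 - A * g x) * (1 - B * g x)).

(** If [g] reached [A^-1], it would do so at some [c > 0] by the intermediate value theorem; there
    the right-hand side of the equation vanishes, whereas [c * q c > 0]. *)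
Lemma ode_below_root s : 0 < A -> 0 < s -> g s < A^-1.
Proof.
move=> A0 s0; rewrite ltNge; apply/negP => Ag.
have gs := ode_gt0 s0.
have cg : {within `[0, s], continuous g}%classic.
  apply: derivable_within_continuous => x; rewrite in_itv/= => /andP[x0 _].
  by have [] := g_derive x0.
have /(IVT (ltW s0) cg)[c] : Num.min (g 0) (g s) <= A^-1 <= Num.max (g 0) (g s).
  by rewrite g0 (min_idPl (ltW gs)) (max_idPr (ltW gs)) invr_ge0 ltW.
rewrite in_itv/= => /andP[c0 _] gc.
have {c0}c0 : 0 < c.
  rewrite lt_neqAle c0 andbT; apply/eqP => c0'.
  by move/eqP: gc; rewrite -c0' g0 eq_sym invr_eq0 gt_eqF.
have := ode (ltW c0); rewrite gc mulfV ?gt_eqF// subrr mul0r mulr0 => /eqP.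
by rewrite mulf_eq0 !gt_eqF// q_gt0// ltW.
Qed.

End Factored.

(* [w = 1 / g^2] satisfies [s w' <= - 2 c], so it becomes negative in finite time. *)
Lemma ode_blowup (Q : R -> R) (c : R) :
  (forall x, 0 <= x -> x * q x = g x * Q (g x)) ->
  0 < c -> ~ (forall x, 0 < x -> c * x ^+ 2 <= Q x).
Proof.
move=> ode c0 Qc.
(* Adding [2 * c * ln x] to [1 / g^2] turns the differential inequality into monotonicity. *)
pose w x := (g x ^+ 2)^-1 + 2 * c * ln x.
have w_derive x : 1 <= x ->
    is_derive x 1 w (- (2 * g x * q x) / (g x ^+ 2) ^+ 2 + 2 * c * x^-1).
  move=> x1; have x0 : 0 < x by rewrite (lt_le_trans ltr01).
  apply: is_derive_addf.
    apply: is_derive_invf; first by rewrite gt_eqF// exprn_gt0// ode_gt0.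
    apply: is_derive_eq; first exact: is_derive_expf (g_derive (ltW x0)).
    by rewrite expr1.
  by apply: is_derive_mulcf; exact: is_derive1_ln.
have w_noninc x : 1 <= x -> w x <= w 1.
  move=> x1; apply: (derive_le0_nonincreasing x1 (df :=
    fun x => - (2 * g x * q x) / (g x ^+ 2) ^+ 2 + 2 * c * x^-1)) => y /andP[y1 _].
    exact: w_derive.
  have y0 : 0 < y by rewrite (lt_trans ltr01).
  have gy := ode_gt0 y0.
  have qE : q y = g y * Q (g y) / y.
    by rewrite -ode ?ltW// mulrAC mulfV ?gt_eqF// mul1r.
  have -> : - (2 * g y * q y) / (g y ^+ 2) ^+ 2 + 2 * c * y^-1 =
      - (2 / y / g y ^+ 2) * (Q (g y) - c * g y ^+ 2).
    by rewrite qE; field; rewrite !gt_eqF.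
  rewrite mulNr oppr_le0 mulr_ge0 ?subr_ge0 ?Qc//.
  by rewrite !mulr_ge0 ?invr_ge0 ?exprn_ge0 ?ltW.
(* Chosen so that [2 * c * ln T = w 1]: then [w T <= w 1] forces [(g T ^+ 2)^-1 <= 0]. Since
   [w 1 >= 0], [T] lies in the range [T >= 1] of the monotonicity. *)
pose T := expR (w 1 / (2 * c)).
have w1 : 0 <= w 1 by rewrite /w ln1 mulr0 addr0 invr_ge0 exprn_ge0// ltW// ode_gt0.
have T1 : 1 <= T.
  by rewrite -expR0 ler_expR divr_ge0// mulr_ge0// ltW.
have wT : w T = (g T ^+ 2)^-1 + w 1.
  by rewrite {1}/w expRK; congr (_ + _); field; rewrite gt_eqF.
have := w_noninc _ T1; rewrite wT gerDr leNgt invr_gt0 exprn_gt0//.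
by rewrite ode_gt0// expR_gt0.
Qed.

(* The quadratic factor has value [1] at [0], so it splits through the roots [A, B] of the
   reciprocal polynomial [y^2 - l y - k]; non-real roots or [A <= 0] would mean blow-up. *)
Lemma ode_factor (l k : R) : k != 0 ->
  (forall x, 0 <= x -> x * q x = g x * (1 - l * g x - k * g x ^+ 2)) ->
  exists A B : R, [/\ B <= A /\ 0 < A, B != 0, l = A + B, k = - (A * B) &
    forall x, 0 <= x -> x * q x = g x * ((1 - A * g x) * (1 - B * g x))].
Proof.
move=> k0 ode.
have nblow c := @ode_blowup (fun y => 1 - l * y - k * y ^+ 2) c ode.
pose d := l ^+ 2 + 4 * k.
have [d0|d0] := ltP d 0.
  (* Completing the square, the quadratic factor is [(1 - l y / 2)^2 - (d / 4) y^2]. *)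
  case: (nblow (- d / 4)); first by rewrite divr_gt0// oppr_gt0.
  move=> x _ /=; rewrite -subr_ge0.
  have -> : 1 - l * x - k * x ^+ 2 - - d / 4 * x ^+ 2 = (1 - l / 2 * x) ^+ 2.
    by rewrite /d; field.
  exact: sqr_ge0.
pose r := Num.sqrt d.
have r0 : 0 <= r := sqrtr_ge0 d.
have rE : r ^+ 2 = l ^+ 2 + 4 * k by rewrite sqr_sqrtr.
pose A := (l + r) / 2; pose B := (l - r) / 2.
have lE : l = A + B by rewrite /A /B; field.
have kE : k = - (A * B).
  have -> : k = (r ^+ 2 - l ^+ 2) / 4 by rewrite rE; field.
  by rewrite /A /B; field.
have BA : B <= A by rewrite /A /B ler_pM2r ?invr_gt0//; lra.
have [A0 B0] : A != 0 /\ B != 0.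
  by move: k0; rewrite kE oppr_eq0 mulf_eq0 negb_or => /andP.
have odeAB x : 0 <= x -> x * q x = g x * ((1 - A * g x) * (1 - B * g x)).
  by move=> /ode ->; rewrite lE kE; congr (_ * _); ring.
have [A_gt0|A_le0] := ltP 0 A; first by exists A, B.
have A_lt0 : A < 0 by rewrite lt_neqAle A0.
have B_lt0 : B < 0 := le_lt_trans BA A_lt0.
(* With [A] and [B] negative, the factor [1 - (A + B) y + A B y^2] exceeds [A B y^2] for [y > 0]. *)
case: (nblow (A * B)); first by rewrite nmulr_rgt0.
move=> x x0 /=; rewrite lE kE -subr_ge0.
have -> : 1 - (A + B) * x - - (A * B) * x ^+ 2 - A * B * x ^+ 2 = 1 + (- (A + B)) * x.
  by ring.
by rewrite addr_ge0// mulr_ge0// ?(ltW x0)//; lra.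
Qed.

(** Separation of variables: by the chain rule [G (g x) - ln x] has derivative zero. The predicate
    [I] confines [G] to values where its logarithms are differentiable. *)
Lemma ode_first_integral (G dG : R -> R) (I : R -> Prop) :
  (forall y, I y -> is_derive y 1 G (dG y)) ->
  (forall x, 0 < x -> I (g x) /\ dG (g x) * q x = x^-1) ->
  exists c, forall x, 0 < x -> G (g x) = ln x + c.
Proof.
move=> G_derive gI; pose h x := G (g x) - ln x.
have h_derive x : 0 < x -> is_derive x 1 h 0.
  move=> x0; have [Ix E] := gI _ x0.
  have -> : 0 = dG (g x) * q x + - x^-1 by rewrite E subrr.
  exact: is_derive_addf (is_derive1_comp (G_derive _ Ix) (g_derive (ltW x0)))
    (is_derive_oppf (is_derive1_ln x0)).
exists (h 1) => x x0.
suff -> : h 1 = h x by rewrite /h addrC subrK.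
have [x1|/ltW x1] := leP 1 x; [apply/esym|];
  by apply: (derive0_cst (df := fun=> 0)) => // y /andP[y1 _]; apply: h_derive;
    apply: lt_le_trans y1.
Qed.

(** The derivative is also that of [ln (y - b)], so partial fractions look the same on either side
    of a root. *)
Lemma is_derive_lnB (b y : R) : y < b -> is_derive y 1 (fun y => ln (b - y)) (y - b)^-1.
Proof.
rewrite -subr_gt0 => yb.
apply: (is_derive_eq (is_derive_lnf (f := fun y => b - y) yb
  (is_derive_addf (is_derive_cst b y 1) (is_derive_oppf (is_derive_id y 1))))).
by rewrite add0r mulN1r -invrN opprB.
Qed.

Lemma is_derive_subc (b y : R) : is_derive y 1 (fun y => y - b) 1.
Proof.
by apply: (is_derive_eq (is_derive_addf (is_derive_id y 1) (is_derive_cst (- b) y 1))); rewrite addr0.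
Qed.

Lemma is_derive_lnBr (b y : R) : b < y -> is_derive y 1 (fun y => ln (y - b)) (y - b)^-1.
Proof.
rewrite -subr_gt0 => yb.
apply: (is_derive_eq (is_derive_lnf (f := fun y => y - b) yb (is_derive_subc b y))).
by rewrite mul1r.
Qed.

(** Partial fractions: [b^2 / (y (y - b)^2) = 1 / y - 1 / (y - b) + b / (y - b)^2]. *)
Lemma double_root_integral (b : R) : 0 < b ->
  (forall x, 0 < x -> 0 < g x < b) ->
  (forall x, 0 < x -> x * q x = b^-1 ^+ 2 * g x * (g x - b) ^+ 2) ->
  exists c, forall x, 0 < x ->
    ln (g x) - ln (b - g x) - b / (g x - b) = ln x + c.
Proof.
move=> b0 gb ode.
apply: (@ode_first_integral (fun y => ln y - ln (b - y) - b / (y - b))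
  (fun y => y^-1 + - (y - b)^-1 + - (b * (- 1 / (y - b) ^+ 2)))
  (fun y => 0 < y < b)) => [y /andP[y0 yb]|x x0].
  apply: is_derive_addf.
    by apply: is_derive_addf; [exact: is_derive1_ln | exact/is_derive_oppf/is_derive_lnB].
  apply/is_derive_oppf/is_derive_mulcf/is_derive_invf; last exact: is_derive_subc.
  by rewrite subr_eq0 lt_eqF.
have /andP[gx0 gxb] := gb x x0; split; first by rewrite gx0.
have -> : q x = b^-1 ^+ 2 * g x * (g x - b) ^+ 2 / x.
  by rewrite -ode// mulrAC mulfV ?gt_eqF// mul1r.
by field; rewrite ?subr_eq0 ?(lt_eqF gxb) ?(gt_eqF gx0) ?(gt_eqF b0) ?(gt_eqF x0).
Qed.

(** Partial fractions of [b c / (y (y - b) (y - c))]; the coefficients are the residues at [0], [b]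
    and [c]. [L] stands for [ln |y - c|], so one proof serves a second root on either side of the
    range of [g]. *)
Lemma simple_roots_integral (b c : R) (L : R -> R) : b != 0 -> c != 0 -> b != c ->
  (forall x, 0 < x -> 0 < g x < b) ->
  (forall x, 0 < x -> is_derive (g x) 1 L (g x - c)^-1 /\ g x != c) ->
  (forall x, 0 < x -> x * q x = (b * c)^-1 * g x * (g x - b) * (g x - c)) ->
  exists k, forall x, 0 < x ->
    ln (g x) + (b * c) / (b * (b - c)) * ln (b - g x)
      + (b * c) / (c * (c - b)) * L (g x) = ln x + k.
Proof.
move=> b0 c0 bc gb gL ode.
apply: (@ode_first_integral
  (fun y => ln y + (b * c) / (b * (b - c)) * ln (b - y) + (b * c) / (c * (c - b)) * L y)
  (fun y => y^-1 + (b * c) / (b * (b - c)) * (y - b)^-1 + (b * c) / (c * (c - b)) * (y - c)^-1)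
  (fun y => 0 < y < b /\ is_derive y 1 L (y - c)^-1)) => [y [/andP[y0 yb] Ly]|x x0].
  exact: (is_derive_addf (is_derive_addf (is_derive1_ln y0)
    (is_derive_mulcf _ (is_derive_lnB yb))) (is_derive_mulcf _ Ly)).
have [Lx gxc] := gL x x0; have /andP[gx0 gxb] := gb x x0; split.
  by split => //; rewrite gx0.
have -> : q x = (b * c)^-1 * g x * (g x - b) * (g x - c) / x.
  by rewrite -ode// mulrAC mulfV ?gt_eqF// mul1r.
have gb0 : g x - b != 0 by rewrite subr_eq0 lt_eqF.
have gc0 : g x - c != 0 by rewrite subr_eq0.
have bc0 : b - c != 0 by rewrite subr_eq0.
have cb0 : c - b != 0 by rewrite subr_eq0 eq_sym.
by field; rewrite ?bc0 ?cb0 ?gb0 ?gc0 ?b0 ?c0 ?(gt_eqF gx0) ?(gt_eqF x0).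
Qed.

End MomentumODE.

(** * Wirtinger derivatives of radial functions *)

Section ComplexDerivatives.
Variables (R : realType) (n : nat).
Implicit Types (z : pt R n) (G : R -> R).

Lemma sq_ge0 z : 0 <= sq z.
Proof. by apply: sumr_ge0 => j _; rewrite addr_ge0 ?sqr_ge0. Qed.

Lemma sqE z : (sq z)%:C%C = \sum_(j < n) conjc (z j) * z j.
Proof.
rewrite /sq rmorph_sum/=; apply: eq_bigr => j _.
by case: (z j) => a b; simpc; congr (Complex _ _); ring.
Qed.

Lemma sq_upd z (j : 'I_n) (w : complex R) :
  sq (upd z j w) = sq z - (complex.Re (z j) ^+ 2 + complex.Im (z j) ^+ 2)
    + (complex.Re w ^+ 2 + complex.Im w ^+ 2).
Proof.
rewrite /sq (bigD1 j)//= [in RHS](bigD1 j)//= /upd eqxx addrC; congr (_ + _).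
rewrite addrAC subrr add0r; apply: eq_bigr => i /negbTE ij.
by rewrite ij.
Qed.

Lemma sq_shift z (j : 'I_n) (v : complex R) :
  sq (upd z j (z j + v)) = sq z
    + 2 * (complex.Re (z j) * complex.Re v + complex.Im (z j) * complex.Im v)
    + (complex.Re v ^+ 2 + complex.Im v ^+ 2).
Proof. by rewrite sq_upd; case: (z j) v => [a b] [c d] /=; ring. Qed.

Lemma is_derive_affine (a b x : R) : is_derive x 1 (fun t => a + b * t) b.
Proof.
rewrite -[X in is_derive _ _ _ X]add0r -[X in is_derive _ _ _ (_ + X)]mulr1.
exact: is_derive_addf (is_derive_cst a x 1) (is_derive_mulcf b (is_derive_id x 1)).
Qed.

Lemma is_derive_quadratic (a b : R) :
  is_derive (0 : R) 1 (fun t => a + b * t + t ^+ 2) b.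
Proof.
apply: (is_derive_eq (is_derive_addf (is_derive_affine a b 0)
  (is_derive_expf 2 (is_derive_id (0 : R) 1)))).
by rewrite /= expr1 mulr0 mul0r addr0.
Qed.

(** On a real coordinate line through [z] the squared norm is [sq z + b t + t^2], with [b] equal to
    [2 Re z_j] or [2 Im z_j]. *)
Lemma is_derive_radial G (a b dG : R) : is_derive a 1 G dG ->
  is_derive (0 : R) 1 (fun t => G (a + b * t + t ^+ 2)) (dG * b).
Proof.
move=> GdG; apply: (@is_derive1_comp R G); last exact: is_derive_quadratic.
by rewrite mulr0 addr0 expr0n/= addr0.
Qed.

Section Direction.
Variables (z : pt R n) (j : 'I_n) (P : pt R n -> complex R) (G : R -> R) (dG : R).
Hypothesis GdG : is_derive (sq z) 1 G dG.
Let F w := P w * (G (sq w))%:C%C.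

(** Treats both real directions at once, [v t] being [t] or [i t]. Every function differentiated
    below is radial or a coordinate times a radial function, so [P] is [1] or a coordinate. *)
Lemma derive_affine_radial (v : R -> complex R) (e : complex R) (b : R) :
  (forall t, sq (upd z j (z j + v t)) = sq z + b * t + t ^+ 2) ->
  (forall t, P (upd z j (z j + v t)) = P z + e * t%:C%C) ->
  Complex (derive1 (fun t => complex.Re (F (upd z j (z j + v t)))) 0)
    (derive1 (fun t => complex.Im (F (upd z j (z j + v t)))) 0) =
  e * (G (sq z))%:C%C + P z * (dG * b)%:C%C.
Proof.
move=> sqv Pv; have dGr := is_derive_radial b GdG.
have FE t : F (upd z j (z j + v t)) =
    (P z + e * t%:C%C) * (G (sq z + b * t + t ^+ 2))%:C%C by rewrite /F sqv Pv.
have ReE : (fun t => complex.Re (F (upd z j (z j + v t)))) =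
    (fun t => (complex.Re (P z) + complex.Re e * t) * G (sq z + b * t + t ^+ 2)).
  by apply/funext => t; rewrite FE; move: (P z) (e) => [a c] [e1 e2]; simpc => /=; ring.
have ImE : (fun t => complex.Im (F (upd z j (z j + v t)))) =
    (fun t => (complex.Im (P z) + complex.Im e * t) * G (sq z + b * t + t ^+ 2)).
  by apply/funext => t; rewrite FE; move: (P z) (e) => [a c] [e1 e2]; simpc => /=; ring.
rewrite ReE ImE !(is_derive1E (is_derive_mulf (is_derive_affine _ _ _) dGr)).
rewrite !mulr0 !addr0 expr0n/= addr0.
by move: (P z) (e) => [a c] [e1 e2]; simpc.
Qed.

Lemma pdx_affine_radial (e : complex R) :
  (forall t, P (upd z j (z j + Complex t 0)) = P z + e * t%:C%C) ->
  pdx j F z = e * (G (sq z))%:C%C + P z * (dG * (2 * complex.Re (z j)))%:C%C.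
Proof.
apply: (derive_affine_radial (v := fun t => Complex t 0)) => t.
by rewrite sq_shift/=; ring.
Qed.

Lemma pdy_affine_radial (e : complex R) :
  (forall t, P (upd z j (z j + Complex 0 t)) = P z + e * t%:C%C) ->
  pdy j F z = e * (G (sq z))%:C%C + P z * (dG * (2 * complex.Im (z j)))%:C%C.
Proof.
apply: (derive_affine_radial (v := fun t => Complex 0 t)) => t.
by rewrite sq_shift/=; ring.
Qed.

End Direction.

Lemma complex_decomp (w : complex R) :
  w = (complex.Re w)%:C%C + ii R * (complex.Im w)%:C%C.
Proof. by case: w => a b; rewrite /ii; simpc. Qed.

Lemma conjc_decomp (w : complex R) :
  conjc w = (complex.Re w)%:C%C - ii R * (complex.Im w)%:C%C.
Proof. by case: w => a b; rewrite /ii; simpc. Qed.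

Lemma ii_sq : ii R * ii R = -1.
Proof. by rewrite /ii; simpc. Qed.

Lemma dzb_radial z (k : 'I_n) G dG : is_derive (sq z) 1 G dG ->
  dzb k (fun w => (G (sq w))%:C%C) z = dG%:C%C * z k.
Proof.
move=> GdG; rewrite /dzb.
have -> : (fun w => (G (sq w))%:C%C) = (fun w : pt R n => 1 * (G (sq w))%:C%C).
  by apply/funext => w; rewrite mul1r.
rewrite (pdx_affine_radial (P := fun=> 1) (e := 0) GdG); last by move=> t; rewrite mul0r addr0.
rewrite (pdy_affine_radial (P := fun=> 1) (e := 0) GdG); last by move=> t; rewrite mul0r addr0.
rewrite !rmorphM/= [in RHS](complex_decomp (z k)) (_ : 2%:C%C = 2%:R) ?rmorph_nat//.
by field.
Qed.

Lemma upd_shift z (j k : 'I_n) (v : complex R) :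
  upd z j (z j + v) k = z k + (k == j)%:R * v.
Proof. by rewrite /upd; case: eqP => [->|_]; rewrite ?mul1r// mul0r addr0. Qed.

(** The coordinate is holomorphic: its contributions cancel by [1 + i * i = 0]. For [dz] the sign is
    opposite and the Kronecker term survives. *)
Lemma dzb_coord_radial z (j k : 'I_n) G dG : is_derive (sq z) 1 G dG ->
  dzb j (fun w => w k * (G (sq w))%:C%C) z = dG%:C%C * z j * z k.
Proof.
move=> GdG; rewrite /dzb.
rewrite (pdx_affine_radial (P := fun w => w k) (e := (k == j)%:R) GdG); last first.
  by move=> t; rewrite upd_shift.
rewrite (pdy_affine_radial (P := fun w => w k) (e := (k == j)%:R * ii R) GdG); last first.
  by move=> t; rewrite upd_shift -mulrA /ii; simpc.
rewrite !rmorphM/= [in RHS](complex_decomp (z j)) (_ : 2%:C%C = 2%:R) ?rmorph_nat//.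
rewrite mulrDr !mulrA [ii R * _ * ii R]mulrAC ii_sq.
by field.
Qed.

Lemma dz_coord_radial z (j k : 'I_n) G dG : is_derive (sq z) 1 G dG ->
  dz j (fun w => w k * (G (sq w))%:C%C) z =
  (k == j)%:R * (G (sq z))%:C%C + dG%:C%C * conjc (z j) * z k.
Proof.
move=> GdG; rewrite /dz.
rewrite (pdx_affine_radial (P := fun w => w k) (e := (k == j)%:R) GdG); last first.
  by move=> t; rewrite upd_shift.
rewrite (pdy_affine_radial (P := fun w => w k) (e := (k == j)%:R * ii R) GdG); last first.
  by move=> t; rewrite upd_shift -mulrA /ii; simpc.
rewrite !rmorphM/= [in RHS](conjc_decomp (z j)) (_ : 2%:C%C = 2%:R) ?rmorph_nat//.
rewrite mulrDr !mulrA [ii R * _ * ii R]mulrAC ii_sq.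
by field.
Qed.

End ComplexDerivatives.

(** * Curvature of a rotationally symmetric metric *)

Section RankOne.
Variables (K : fieldType) (n : nat).

(** The matrix determinant lemma: multiplication by unipotent block-triangular matrices on both
    sides makes the bordered matrix block upper triangular. *)
Lemma det_rank_one_update (c : 'cV[K]_n) (r : 'rV[K]_n) :
  \det (1%:M + c *m r) = 1 + (r *m c) 0 0.
Proof.
have E : block_mx 1%:M 0 r 1%:M *m block_mx (1%:M + c *m r) c 0 1%:M *m
    block_mx 1%:M 0 (- r) 1%:M = block_mx 1%:M c 0 (1 + r *m c).
  rewrite !mulmx_block !(mul1mx, mulmx1, mul0mx, mulmx0, add0r, addr0).
  rewrite mulmxN addrK mulmxDr mulmx1 mulmxDl mul1mx mulmxN mulmxA.
  by congr block_mx; rewrite [RHS]addrC// || rewrite -opprD [_ + r]addrC subrr.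
have /(congr1 determinant) := E.
rewrite !det_mulmx !det_lblock !det_ublock !det1 !mul1r !mulr1 => ->.
by rewrite det_mx11 !mxE.
Qed.

End RankOne.

(** * The embedding of the reals into the complex numbers *)

Section RealComplex.
Variable R : rcfType.
Implicit Types x y : R.

Lemma realc_eq0 x : (x%:C%C == 0) = (x == 0).
Proof. exact: (fmorph_eq0 (real_complex R)). Qed.

Lemma realcD x y : (x + y)%:C%C = x%:C%C + y%:C%C.
Proof. exact: (rmorphD (real_complex R)). Qed.

Lemma realcM x y : (x * y)%:C%C = x%:C%C * y%:C%C.
Proof. exact: (rmorphM (real_complex R)). Qed.

Lemma realcX x k : (x ^+ k)%:C%C = x%:C%C ^+ k.
Proof. exact: (rmorphXn (real_complex R)). Qed.

Lemma realcN x : (- x)%:C%C = - x%:C%C.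
Proof. exact: (rmorphN (real_complex R)). Qed.

Lemma realc_nat k : (k%:R : R)%:C%C = k%:R.
Proof. exact: (rmorph_nat (real_complex R)). Qed.

End RealComplex.

(** Realises each [s >= 0] as a value of [sq], so that identities on complex space descend to
    identities in [s]. *)
Definition axis_point (R : realType) (n : nat) (s : R) : pt R n.+1 :=
  fun j => if j == ord0 then (Num.sqrt s)%:C%C else 0.

Arguments axis_point {R} n s.

Lemma sq_axis_point (R : realType) (n : nat) (s : R) : 0 <= s -> sq (axis_point n s) = s.
Proof.
move=> s0; rewrite /sq (bigD1 ord0)//= big1 ?addr0 /axis_point; last first.
  by move=> i /negbTE ->; rewrite /= expr0n addr0.
by rewrite /= sqr_sqrtr// expr0n addr0.
Qed.

Section RotationallySymmetricMetric.
Variables (R : realType) (n : nat) (u : R -> R).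
Implicit Types (z : pt R n.+1) (s t : R).
Let p : R -> R := derive1 u.
Let u2 : R -> R := derive1 (derive1 u).
Let q (s : R) : R := p s + s * u2 s.

Lemma metric_rank_one z : metric u z =
  (p (sq z))%:C%C%:M + (\col_j ((u2 (sq z))%:C%C * conjc (z j))) *m (\row_k z k).
Proof.
apply/matrixP => j k; rewrite !mxE big_ord1 !mxE; congr (_ + _).
by case: eqP => _; rewrite ?mulr1n ?mulr0n.
Qed.

Lemma row_mul_col z (a : complex R) :
  ((\row_k z k) *m (\col_j (a * conjc (z j)))) 0 0 = a * (sq z)%:C%C.
Proof.
rewrite mxE sqE mulr_sumr; apply: eq_bigr => i _.
by rewrite !mxE mulrCA [z i * _]mulrC.
Qed.

Lemma det_metric z : p (sq z) != 0 ->
  \det (metric u z) = (p (sq z) ^+ n * q (sq z))%:C%C.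
Proof.
move=> p0; set a := (p (sq z))%:C%C.
have a0 : a != 0 by rewrite realc_eq0.
have -> : metric u z = a *: (1%:M +
    (\col_j (a^-1 * (u2 (sq z))%:C%C * conjc (z j))) *m (\row_k z k)).
  rewrite metric_rank_one scalerDr scale_scalar_mx mulr1 scalemxAl; congr (_ + _ *m _).
  by apply/colP => j; rewrite !mxE !mulrA mulfV// mul1r.
rewrite detZ det_rank_one_update row_mul_col exprSr -mulrA mulrDr mulr1 !mulrA mulfV// mul1r.
by rewrite /q realcM realcX realcD realcM [(sq z)%:C%C * _]mulrC.
Qed.

(** The Sherman-Morrison formula, with denominator [q = p + s * u2]. The indices appear swapped
    because [invmetric] transposes the inverse matrix. *)
Lemma invmetricE z (j k : 'I_n.+1) : p (sq z) != 0 -> q (sq z) != 0 ->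
  invmetric u z j k = (p (sq z))^-1%:C%C * (k == j)%:R +
    (- (u2 (sq z) / (p (sq z) * q (sq z))))%:C%C * (z j * conjc (z k)).
Proof.
move=> p0 q0; set a := (p (sq z))%:C%C; set t := (- (u2 (sq z) / (p (sq z) * q (sq z))))%:C%C.
set c : 'cV[complex R]_n.+1 := \col_j ((u2 (sq z))%:C%C * conjc (z j)).
set r : 'rV[complex R]_n.+1 := \row_k z k.
pose N : 'M[complex R]_n.+1 := ((p (sq z))^-1)%:C%C%:M + t *: ((\col_j conjc (z j)) *m r).
suff MN : metric u z *m N = 1%:M.
  rewrite /invmetric; have [Mu _] := mulmx1_unit MN.
  have -> : invmx (metric u z) = N by rewrite -[N](mulKmx Mu) MN mulmx1.
  rewrite !mxE big_ord1 !mxE mulr_natr; congr (_ + _ * _).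
  exact: mulrC.
rewrite metric_rank_one -/c -/r.
have cE : c = (u2 (sq z))%:C%C *: (\col_j conjc (z j)) by apply/colP => i; rewrite !mxE.
set e := \col_j conjc (z j) in N cE *.
have re : r *m e = (sq z)%:C%C%:M.
  rewrite [LHS]mx11_scalar; congr (_%:M).
  rewrite -[RHS]mul1r -row_mul_col; congr ((_ *m _) 0 0).
  by apply/colP => i; rewrite !mxE mul1r.
rewrite /N cE mulmxDl !mulmxDr !mul_scalar_mx mul_mx_scalar -!scalemxAl -!scalemxAr.
rewrite -[e *m r *m (e *m r)]mulmxA [r *m (e *m r)]mulmxA re mul_scalar_mx -scalemxAr.
rewrite scale_scalar_mx !scalerA -!scalerDl -addrA -!scalerDl -realcM mulfV//.
(* The remaining coefficient of the rank-one part is [u2 / p + t * (p + s * u2)], zero by the choice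
   of [t]. *)
rewrite [X in X *: _](_ : _ = 0) ?scale0r ?addr0//.
rewrite /t /a -!realcM -!realcD -[RHS]/((0 : R)%:C%C); congr (_%:C%C).
by move: q0; rewrite /q => q0; field; rewrite p0 q0.
Qed.

(** Used with the inverse metric as first factor and the complex Hessian of [log det] as second;
    both are scalar plus rank one, so the contraction depends on [|z|^2] only. *)
Lemma hermitian_trace z (al be a b : complex R) :
  \sum_(j < n.+1) \sum_(k < n.+1)
    (al * (k == j)%:R + be * (z j * conjc (z k))) *
    ((k == j)%:R * a + b * conjc (z j) * z k) =
  al * a * n.+1%:R + (al * b + be * a) * (sq z)%:C%C + be * b * (sq z)%:C%C ^+ 2.
Proof.
have inner j : \sum_(k < n.+1)
    (al * (k == j)%:R + be * (z j * conjc (z k))) *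
    ((k == j)%:R * a + b * conjc (z j) * z k) =
    al * a + (al * b + be * a) * (conjc (z j) * z j)
    + be * b * (sq z)%:C%C * (conjc (z j) * z j).
  transitivity (\sum_(k < n.+1) ((if k == j then
      al * a + (al * b + be * a) * (conjc (z j) * z j) else 0)
      + be * b * (conjc (z j) * z j) * (conjc (z k) * z k))).
    by apply: eq_bigr => k _; case: eqP => [->|_] /=; ring.
  rewrite big_split/= -big_mkcond big_pred1_eq -mulr_sumr -sqE; ring.
under eq_bigr do rewrite inner.
rewrite !big_split/= -!mulr_sumr -sqE sumr_const card_ord -mulr_natr; ring.
Qed.

Section Radial.
Hypothesis p_gt0 : forall s, 0 <= s -> 0 < p s.
Hypothesis q_gt0 : forall s, 0 <= s -> 0 < q s.

Let p_neq0 z : p (sq z) != 0. Proof. by rewrite gt_eqF// p_gt0// sq_ge0. Qed.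
Let q_neq0 z : q (sq z) != 0. Proof. by rewrite gt_eqF// q_gt0// sq_ge0. Qed.

Lemma logdet_radial :
  logdet u = fun z => (n%:R * ln (p (sq z)) + ln (q (sq z)))%:C%C.
Proof.
apply/funext => z; rewrite /logdet det_metric//= lnM ?posrE ?exprn_gt0//.
- by rewrite lnXn ?p_gt0 ?sq_ge0// mulr_natl.
- by rewrite p_gt0// sq_ge0.
- by rewrite q_gt0// sq_ge0.
Qed.

(** The complex Hessian of [log det] has the eigendirections of the metric, with eigenvalues [F1]
    ([n] times) and [F1 + s * F2] (radial); the trace adds their quotients by [p] and [q]. *)
Lemma scal_radial (F1 F2 : R -> R) :
  (forall s, 0 <= s -> is_derive s 1 (fun t => n%:R * ln (p t) + ln (q t)) (F1 s)) ->
  (forall s, 0 <= s -> is_derive s 1 F1 (F2 s)) ->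
  scal u = fun z => (- (n%:R * F1 (sq z) / p (sq z)
    + (F1 (sq z) + sq z * F2 (sq z)) / q (sq z)))%:C%C.
Proof.
move=> dF dF1; apply/funext => z; rewrite /scal logdet_radial [RHS]realcN; congr (- _).
have dzbE k : dzb k (fun w : pt R n.+1 => (n%:R * ln (p (sq w)) + ln (q (sq w)))%:C%C) =
    (fun w => w k * (F1 (sq w))%:C%C).
  apply/funext => w; rewrite mulrC.
  exact: (dzb_radial (G := fun s => n%:R * ln (p s) + ln (q s)) k (dF _ (sq_ge0 w))).
under eq_bigr => j _ do under eq_bigr => k _ do
  rewrite dzbE (dz_coord_radial j k (dF1 _ (sq_ge0 z))) invmetricE//.
rewrite hermitian_trace -realc_nat -!realcX -!realcM -!realcD.
rewrite -?realcM -?realcD; congr (_%:C%C).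
have := q_neq0 z; rewrite -natr1 /q => q0.
by field; rewrite p_neq0 q0.
Qed.

(** The antiholomorphic gradient of [S] is [S1] times [z], and the inverse metric acts on the radial
    direction as [1 / q]. *)
Lemma gradR_radial (S S1 : R -> R) : @scal R n.+1 u = (fun z => (S (sq z))%:C%C) ->
  (forall s, 0 <= s -> is_derive s 1 S (S1 s)) ->
  forall a, gradR u a = fun z => z a * (S1 (sq z) / q (sq z))%:C%C.
Proof.
move=> SE dS a; apply/funext => z; rewrite /gradR SE.
under eq_bigr => b _ do rewrite (dzb_radial b (dS _ (sq_ge0 z))) invmetricE//.
transitivity (\sum_(b < n.+1) ((if b == a then ((p (sq z))^-1 * S1 (sq z))%:C%C * z a else 0)
   + (- (u2 (sq z) / (p (sq z) * q (sq z))) * S1 (sq z))%:C%C * z a * (conjc (z b) * z b))).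
  by apply: eq_bigr => b _; rewrite !realcM; case: eqP => [->|_] /=; ring.
rewrite big_split/= -big_mkcond big_pred1_eq -mulr_sumr -sqE.
rewrite -[_ * z a * _]mulrAC -realcM -mulrDl -realcD mulrC; congr (_ * _%:C%C).
have := q_neq0 z; rewrite /q => q0.
by field; rewrite p_neq0 q0.
Qed.

(** A single component at a single point suffices: at the axis point it reads [H1 s * s = 0]. *)
Lemma extremal_radial (H H1 : R -> R) :
  (forall a, @gradR R n.+1 u a = fun z => z a * (H (sq z))%:C%C) ->
  (forall s, 0 <= s -> is_derive s 1 H (H1 s)) ->
  @extremal R n.+1 u -> forall s, 0 < s -> H1 s = 0.
Proof.
move=> gE dH ext s s0; pose z := axis_point n s.
have sqz : sq z = s := sq_axis_point n (ltW s0).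
have := ext ord0 ord0 z; rewrite gE (dzb_coord_radial ord0 ord0 (dH _ (sq_ge0 z))) sqz.
rewrite /z /axis_point eqxx -mulrA -!realcM -expr2 sqr_sqrtr ?ltW// => /eqP.
by rewrite realc_eq0 mulf_eq0 (gt_eqF s0) orbF => /eqP.
Qed.

End Radial.
End RotationallySymmetricMetric.

(** * Extremal metrics *)

Lemma open_gt0_derivable (R : realType) (D : set R) (f : R -> R) : open D ->
  (forall x, D x -> derivable f x 1) -> open (D `&` [set x | 0 < f x])%classic.
Proof.
move=> oD df; rewrite openE => x [Dx fx0].
apply: filterI; first by apply: open_nbhs_nbhs; split.
have cf : {for x, continuous f}.
  by apply: differentiable_continuous; apply/derivable1_diffP/df.
exact: (cvgr_gt (f x) cf).
Qed.

Lemma Ck_sub (R : realType) (D E : set R) (k : nat) (f : R -> R) :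
  (D `<=` E)%classic -> Ck E k f -> Ck D k f.
Proof.
move=> DE; elim: k f => // k IHk f [df Cf].
by split=> [x /DE /df //|]; exact: IHk.
Qed.

Lemma smooth_on_derive1n (R : realType) (D : set R) (f : R -> R) :
  (forall k x, D x -> derivable (derive1n k f) x 1) -> smooth_on D f.
Proof.
move=> df k; rewrite -[f]/(derive1n 0 f).
elim: k 0%N => // k IHk j; split; first exact: df.
exact: (IHk j.+1).
Qed.

Section Extremal.
Variables (R : realType) (m : nat) (u : R -> R).
Hypothesis smooth_u : smooth_near_nonneg u.
Hypothesis kahler_u : kahler_potential u.
Hypothesis extremal_u : @extremal R m.+2 u.
Implicit Types s t : R.
Let p : R -> R := derive1 u.
Let q s : R := p s + s * derive1 p s.
Let g s : R := s * p s.

(** Positivity is given for [s >= 0] only, but two-sided derivatives of logarithms and quotients at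
    [0] call for an open set; positivity persists nearby by continuity. *)
Lemma smooth_domain : exists D : set R, [/\ open D, forall s, 0 <= s -> D s,
  forall s, D s -> 0 < p s, forall s, D s -> 0 < q s & smooth_on D p].
Proof.
have [eps [eps0 du]] := smooth_u.
pose E : set R := [set s | - eps < s]%classic.
have oE : open E by exact: open_gt.
have Sp : smooth_on E p by apply/smooth_derive1/smooth_on_derive1n => k x; exact: du.
have Sq : smooth_on E q.
  by apply: smooth_add => //; apply: smooth_mul => //; [exact: smooth_id | exact: smooth_derive1].
pose E1 := (E `&` [set s | 0 < p s])%classic.
have oE1 : open E1 by apply: open_gt0_derivable => // x Ex; have [] := Sp 1%N => /(_ x Ex).
exists (E1 `&` [set s | 0 < q s])%classic; split.
- by apply: open_gt0_derivable => // x [Ex _]; have [] := Sq 1%N => /(_ x Ex).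
- move=> s s0; have [ps qs] := kahler_u s0; split => //; split => //.
  by rewrite /E /= (lt_le_trans _ s0)// oppr_lt0.
- by move=> s [[]].
- by move=> s [].
- by move=> k; apply: Ck_sub (Sp k) => s [[]].
Qed.

Lemma p_gt0 s : 0 <= s -> 0 < p s. Proof. by case/kahler_u. Qed.
Lemma q_gt0 s : 0 <= s -> 0 < q s. Proof. by case/kahler_u. Qed.

Lemma g_derive s : 0 <= s -> is_derive s 1 g (q s).
Proof.
move=> s0; have [D [oD D0 _ _ Sp]] := smooth_domain.
apply: (is_derive_eq (is_derive_mulf (is_derive_id s 1) (smooth_is_derive Sp (D0 s s0)))).
by rewrite mul1r.
Qed.

(** Extremality makes [S' / g'] a constant [k], and integrating [S' = k * g'] gives the affine form.
    The derivatives [F1], [F2] and [q1] are exported for the later integrations. *)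
Lemma extremal_scal_affine : exists (k l : R) (F1 F2 q1 : R -> R),
  [/\ @scal R m.+2 u = fun z => (k * g (sq z) + l)%:C%C,
    forall s, 0 <= s -> is_derive s 1 q (q1 s),
    forall s, 0 <= s -> is_derive s 1 F1 (F2 s),
    forall s, 0 <= s -> F1 s = m.+1%:R * (derive1 p s / p s) + q1 s / q s &
    forall s, 0 <= s ->
      - (m.+1%:R * F1 s / p s + (F1 s + s * F2 s) / q s) = k * g s + l].
Proof.
have [D [oD D0 Dp Dq Sp]] := smooth_domain.
have Sid : smooth_on D (fun s => s) := smooth_id oD.
have Sq : smooth_on D q := smooth_add oD Sp (smooth_mul oD Sid (smooth_derive1 Sp)).
have Ip : smooth_on D (fun s => (p s)^-1).
  by apply: (smooth_inv oD) => // s /Dp /lt0r_neq0.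
have Iq : smooth_on D (fun s => (q s)^-1).
  by apply: (smooth_inv oD) => // s /Dq /lt0r_neq0.
pose F s := m.+1%:R * ln (p s) + ln (q s).
have SF : smooth_on D F := smooth_add oD
  (smooth_mul oD (smooth_cst oD m.+1%:R) (smooth_ln oD Dp Sp)) (smooth_ln oD Dq Sq).
have SF1 := smooth_derive1 SF; have SF2 := smooth_derive1 SF1.
set F1 := derive1 F in SF1 SF2; set F2 := derive1 F1 in SF2.
pose S s := - (m.+1%:R * F1 s / p s + (F1 s + s * F2 s) / q s).
have SS : smooth_on D S := smooth_opp oD (smooth_add oD
  (smooth_mul oD (smooth_mul oD (smooth_cst oD m.+1%:R) SF1) Ip)
  (smooth_mul oD (smooth_add oD SF1 (smooth_mul oD Sid SF2)) Iq)).
have SS1 := smooth_derive1 SS; set S1 := derive1 S in SS1.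
pose H s := S1 s / q s.
have SH : smooth_on D H := smooth_mul oD SS1 Iq.
have der f (Sf : smooth_on D f) s : 0 <= s -> is_derive s 1 f (derive1 f s).
  by move=> /D0; exact: smooth_is_derive.
have scalE : @scal R m.+2 u = fun z => (S (sq z))%:C%C.
  exact: (scal_radial p_gt0 q_gt0 (der _ SF) (der _ SF1)).
have gradE := gradR_radial p_gt0 q_gt0 scalE (der _ SS).
have H1 := extremal_radial gradE (der _ SH) extremal_u.
(* [H] is known to have zero derivative for [s > 0] only; the mean value theorem needs no more, so
   the constant can be read off at [0]. *)
pose k := H 0.
have S1E s : 0 <= s -> S1 s = k * q s.
  move=> s0; have HE : H s = H 0.
    refine (derive0_cst s0 (df := derive1 H) _ _) => t /andP[t0 _]; first exact: der.
    exact: H1.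
  by rewrite /k -HE -[H s]/(S1 s / q s) (divfK (lt0r_neq0 (q_gt0 s0))).
have SE s : 0 <= s -> S s = k * g s + S 0.
  move=> s0; apply/eqP; rewrite addrC -subr_eq; apply/eqP.
  have -> : S 0 = S 0 - k * g 0 by rewrite /g mul0r mulr0 subr0.
  refine (derive0_cst (f := fun s => S s - k * g s) (df := fun s => S1 s - k * q s) s0 _ _).
    move=> t /andP[t0 _].
    exact: is_derive_addf (der _ SS t t0) (is_derive_oppf (is_derive_mulcf k (g_derive t0))).
  by move=> t /andP[t0 _]; rewrite S1E ?ltW// subrr.
exists k, (S 0), F1, F2, (derive1 q); split.
- by rewrite scalE; apply/funext => z; rewrite SE ?sq_ge0.
- exact: (der _ Sq).
- exact: (der _ SF1).
- move=> s s0; apply: is_derive1E.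
  exact: is_derive_addf
    (is_derive_mulcf m.+1%:R (is_derive_lnf (p_gt0 s0) (der _ Sp s s0)))
    (is_derive_lnf (q_gt0 s0) (der _ Sq s s0)).
- exact: SE.
Qed.

(* Two integrations: the trace equation is [(s F' g^(n-1))' = - (k g + l) g^(n-1) g'], and then
   [(s g' g^(n-1))' = (n + s F') g^(n-1) g'], where [F = log det] and [n = m + 2]. *)
Lemma extremal_ode : exists k l : R,
  @scal R m.+2 u = (fun z => (k * g (sq z) + l)%:C%C) /\
  forall s, 0 <= s -> s * q s = g s * (1 - l / (m.+2%:R * m.+3%:R) * g s
    - k / (m.+3%:R * m.+4%:R) * g s ^+ 2).
Proof.
have [k [l [F1 [F2 [q1 [scalE dq dF1 F1E SE]]]]]] := extremal_scal_affine.
exists k, l; split=> //.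
have gpow_gt0 s i : 0 < s -> 0 < g s ^+ i.
  by move=> s0; rewrite exprn_gt0// mulr_gt0// p_gt0// ltW.
have g0 : g 0 = 0 by rewrite /g mul0r.
pose E s := - k / m.+3%:R * g s ^+ 2 - l / m.+2%:R * g s.
have sF1 s : 0 <= s -> s * F1 s = E s.
  rewrite le_eqVlt => /predU1P[<-|s0].
    by rewrite /E g0 expr0n !mulr0 mul0r subr0.
  (* [W] is constant and vanishes at [0] because [g 0 = 0]; dividing by [g ^+ m.+1] then gives
     [s * F1 s = E s]. *)
  pose W t := t * F1 t * g t ^+ m.+1 + k / m.+3%:R * g t ^+ m.+3 + l / m.+2%:R * g t ^+ m.+2.
  have : W s = W 0.
    refine (derive0_cst (ltW s0) (df := fun t =>
      (1 * F1 t + t * F2 t) * g t ^+ m.+1 + t * F1 t * (m.+1%:R * g t ^+ m * q t)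
      + k / m.+3%:R * (m.+3%:R * g t ^+ m.+2 * q t)
      + l / m.+2%:R * (m.+2%:R * g t ^+ m.+1 * q t)) _ _) => t /andP[t0 _].
      apply: is_derive_addf; last exact/is_derive_mulcf/is_derive_expf/g_derive.
      apply: is_derive_addf; last exact/is_derive_mulcf/is_derive_expf/g_derive.
      apply: is_derive_mulf; last exact/is_derive_expf/g_derive.
      exact: is_derive_mulf (is_derive_id t 1) (dF1 t t0).
    have := SE t (ltW t0); have := lt0r_neq0 (p_gt0 (ltW t0)).
    have := lt0r_neq0 (q_gt0 (ltW t0)); rewrite !exprS /g.
    move: (p t) (q t) (F1 t) (F2 t) ((t * p t) ^+ m) => P Q A B G Q0 P0 eqS.
    (* The trace equation solved for [(s F')']; its last term cancels the one from differentiating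
       [g ^+ m.+1], as [g = t * P]. *)
    have -> : 1 * A + t * B = - Q * (k * (t * P) + l) - m.+1%:R * Q * A / P.
      by rewrite -eqS; field; rewrite P0 Q0.
    by field; rewrite P0 -!natrD !pnatr_eq0.
  rewrite /W g0 !expr0n /= !mulr0 !addr0 => /eqP W0.
  have := gpow_gt0 s m.+1 s0 => /lt0r_neq0 /mulIf; apply.
  move: W0; rewrite -addrA addr_eq0 => /eqP ->.
  by rewrite /E !exprS; ring.
move=> s; rewrite le_eqVlt => /predU1P[<-|s0]; first by rewrite g0 !mul0r.
pose W t := t * q t * g t ^+ m.+1 - g t ^+ m.+2 + k / (m.+3%:R * m.+4%:R) * g t ^+ m.+4
  + l / (m.+2%:R * m.+3%:R) * g t ^+ m.+3.
have : W s = W 0.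
  refine (derive0_cst (ltW s0) (df := fun t =>
    (1 * q t + t * q1 t) * g t ^+ m.+1 + t * q t * (m.+1%:R * g t ^+ m * q t)
    - m.+2%:R * g t ^+ m.+1 * q t
    + k / (m.+3%:R * m.+4%:R) * (m.+4%:R * g t ^+ m.+3 * q t)
    + l / (m.+2%:R * m.+3%:R) * (m.+3%:R * g t ^+ m.+2 * q t)) _ _) => t /andP[t0 _].
    apply: is_derive_addf; last exact/is_derive_mulcf/is_derive_expf/g_derive.
    apply: is_derive_addf; last exact/is_derive_mulcf/is_derive_expf/g_derive.
    apply: is_derive_addf; last exact/is_derive_oppf/is_derive_expf/g_derive.
    apply: is_derive_mulf; last exact/is_derive_expf/g_derive.
    exact: is_derive_mulf (is_derive_id t 1) (dq t t0).
  have := sF1 t (ltW t0); rewrite F1E ?ltW// /E.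
  have := lt0r_neq0 (p_gt0 (ltW t0)); have := lt0r_neq0 (q_gt0 (ltW t0)).
  rewrite !exprS /g /q.
  move: (p t) (derive1 p t) (q1 t) ((t * p t) ^+ m) => P P1 Q1 G.
  set Q := P + t * P1 => Q0 P0 eqF.
  (* Solves [s F' = (n - 1) s p' / p + s q' / q] for [s q'], using [s p' = q - p]. *)
  have -> : t * Q1 = Q * (- k / m.+3%:R * (t * P * (t * P)) - l / m.+2%:R * (t * P)
      - m.+1%:R * (Q - P) / P).
    have -> : - k / m.+3%:R * (t * P * (t * P)) - l / m.+2%:R * (t * P) =
      t * (m.+1%:R * (P1 / P) + Q1 / Q) by rewrite eqF; ring.
    by move: Q0; rewrite /Q => Q0; field; rewrite P0 Q0.
  by move: Q Q0 {eqF} => Q Q0; field; rewrite P0 -!natrD !pnatr_eq0.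
have -> : W 0 = 0.
  by rewrite /W g0; move: (q 0) => Q; rewrite !expr0n /= !mulr0 subr0 !addr0.
rewrite /W; move: (q s) (g s) (gpow_gt0 s m.+1 s0) => Q G /lt0r_neq0 G0 W0.
apply: (mulIf G0); apply/eqP; rewrite -subr_eq0 -[X in _ == X]W0; apply/eqP.
by rewrite !exprS; ring.
Qed.

End Extremal.

(** * The case distinction on the roots of the quadratic factor *)

Unset Implicit Arguments.

Theorem theorem1p1 (R : realType) (n : nat) (u : R -> R) :
  (2 <= n)%N ->
  smooth_near_nonneg u ->
  kahler_potential u ->
  @extremal R n u ->
  let g := fun s : R => s * derive1 u s in
  (* (1) *)
  @cscK R n u
  \/
  (* (2) *)
  (exists beta c : R, 0 < beta /\
     (forall s : R, 0 < s ->
        0 < g s < beta /\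
        s * derive1 g s = beta^-1 ^+ 2 * g s * (g s - beta) ^+ 2 /\
        ln (g s) - ln (beta - g s) - beta / (g s - beta) = ln s + c) /\
     {in `]0, +oo[ &, {mono g : x y / x < y}} /\
     (forall z : pt R n, 0 < @scal R n u z) /\ ~ @cscK R n u)
  \/
  (* (3) *)
  (exists gamma beta c : R, gamma < 0 < beta /\
     (forall s : R, 0 < s ->
        0 < g s < beta /\
        s * derive1 g s = (beta * gamma)^-1 * g s * (g s - beta) * (g s - gamma) /\
        ln (g s) + (beta * gamma) / (beta * (beta - gamma)) * ln (beta - g s)
          + (beta * gamma) / (gamma * (gamma - beta)) * ln (g s - gamma)
          = ln s + c) /\
     {in `]0, +oo[ &, {mono g : x y / x < y}})
  \/
  (* (4) *)
  (exists gamma beta c : R, 0 < beta < gamma /\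
     (forall s : R, 0 < s ->
        0 < g s < beta /\
        s * derive1 g s = (beta * gamma)^-1 * g s * (g s - beta) * (g s - gamma) /\
        ln (g s) + (beta * gamma) / (beta * (beta - gamma)) * ln (beta - g s)
          + (beta * gamma) / (gamma * (gamma - beta)) * ln (gamma - g s)
          = ln s + c) /\
     {in `]0, +oo[ &, {mono g : x y / x < y}}).
Proof.
case: n => [|[|m]] // _ smooth_u kahler_u extremal_u g.
pose q (s : R) : R := derive1 u s + s * derive1 (derive1 u) s.
have g0 : g 0 = 0 by rewrite /g mul0r.
have dg (s : R) : 0 <= s -> is_derive s 1 g (q s) := @g_derive R u smooth_u kahler_u s.
have qpos (s : R) : 0 <= s -> 0 < q s by case/kahler_u.
have [k [l [scalE ode]]] : exists k l : R,
    @scal R m.+2 u = (fun z => (k * g (sq z) + l)%:C%C) /\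
    forall s, 0 <= s -> s * q s = g s * (1 - l / (m.+2%:R * m.+3%:R) * g s
      - k / (m.+3%:R * m.+4%:R) * g s ^+ 2) := extremal_ode smooth_u kahler_u extremal_u.
have [k0|k0] := eqVneq k 0.
  by left; exists l%:C%C => z; rewrite scalE k0 mul0r add0r.
right.
have k'0 : k / (m.+3%:R * m.+4%:R) != 0.
  by rewrite mulf_neq0// invr_neq0// mulf_neq0 ?pnatr_eq0.
(* As [B <= A] and [0 < A], the least positive root is [A^-1], which serves as [beta]; [B^-1] serves
   as [gamma]. *)
have [A [B [[BA A0] B0 lE kE odeAB]]] := ode_factor g0 dg qpos k'0 ode.
have gbound (s : R) : 0 < s -> 0 < g s < A^-1.
  by move=> s0; rewrite (ode_gt0 g0 dg qpos s0) (ode_below_root g0 dg qpos odeAB A0 s0).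
have g_mono := ode_mono dg qpos.
have g_der (s : R) : 0 < s -> derive1 g s = q s by move=> /ltW /dg /is_derive1E.
have A'0 : 0 < A^-1 by rewrite invr_gt0.
have odeq (s : R) : 0 < s -> s * q s = (A^-1 * B^-1)^-1 * g s * (g s - A^-1) * (g s - B^-1).
  by move=> /ltW /odeAB ->; field; rewrite B0 gt_eqF.
have [AB|AB] := eqVneq B A; [left|right].
  have odeA (s : R) : 0 < s -> s * q s = A^-1^-1 ^+ 2 * g s * (g s - A^-1) ^+ 2.
    by move=> /odeq ->; rewrite AB; field; rewrite gt_eqF.
  have [c cE] := double_root_integral dg A'0 gbound odeA.
  exists A^-1, c; split=> //; split.
    by move=> s s0; split; [exact: gbound | rewrite g_der//; split; [exact: odeA | exact: cE]].
  split=> //; split.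
    move=> z; rewrite scalE ltcR.
    have gz : A * g (sq z) < 1.
      have := sq_ge0 z; rewrite le_eqVlt => /predU1P[<-|/gbound /andP[_ gA]].
        by rewrite g0 mulr0.
      by rewrite -(ltr_pM2l A0) mulfV ?gt_eqF// in gA.
    have kE' : k = - A ^+ 2 * (m.+3%:R * m.+4%:R).
      by rewrite expr2 -{2}AB -kE divfK// mulf_neq0// pnatr_eq0.
    have lE' : l = 2 * A * (m.+2%:R * m.+3%:R).
      rewrite mulr_natl mulr2n -{2}AB -lE divfK// mulf_neq0// pnatr_eq0.
    (* The double root determines [k] and [l] from [A]; in this form positivity follows from
       [A * g < 1], which includes the origin. *)
    have -> : k * g (sq z) + l = m.+3%:R * A * (m.+4%:R * (1 - A * g (sq z)) + m%:R).
      by rewrite kE' lE' -!natr1; ring.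
    by rewrite mulr_gt0 ?mulr_gt0// ltr_wpDr// mulr_gt0// subr_gt0.
  (* Comparing the scalar curvature at [s = 0] and [s = 1] would give [k * g 1 = 0]. *)
  move=> [w wE].
  have wS (s : R) : 0 <= s -> w = (k * g s + l)%:C%C.
    by move=> s0; rewrite -(wE (axis_point m.+1 s)) scalE sq_axis_point.
  have /(congr1 (@complex.Re R))/= := etrans (esym (wS 0 (lexx 0))) (wS 1 ler01).
  rewrite g0 mulr0 => /addIr /esym/eqP; rewrite mulf_eq0 (negbTE k0)/= gt_eqF//.
  by have /andP[] := gbound 1 ltr01.
have inv_neq : A^-1 != B^-1 by rewrite (inj_eq invr_inj) eq_sym.
have A'B' : A^-1 != 0 /\ B^-1 != 0 by rewrite !invr_eq0 gt_eqF.
(* A positive [B] is less than [A], so [gamma] exceeds [beta]; otherwise [gamma] is negative. [L] is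
   the logarithm defined on the range of [g]. *)
have [Bpos|Bneg] := ltP 0 B; [right|left].
  have BA' : A^-1 < B^-1 by rewrite ltf_pV2 ?posrE// lt_neqAle AB.
  have [c cE] := simple_roots_integral (L := fun y => ln (B^-1 - y)) dg A'B'.1 A'B'.2 inv_neq gbound
    (fun s s0 => let gB := lt_trans (andP (gbound s s0)).2 BA' in
      conj (is_derive_lnB gB) (negbT (lt_eqF gB))) odeq.
  exists B^-1, A^-1, c; rewrite A'0 BA'; split=> //; split=> // s s0.
  by split; [exact: gbound | rewrite g_der//; split; [exact: odeq | exact: cE]].
have B'0 : B^-1 < 0 by rewrite invr_lt0 lt_neqAle B0.
have [c cE] := simple_roots_integral (L := fun y => ln (y - B^-1)) dg A'B'.1 A'B'.2 inv_neq gbound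
  (fun s s0 => let gB := lt_trans B'0 (andP (gbound s s0)).1 in
    conj (is_derive_lnBr gB) (negbT (gt_eqF gB))) odeq.
exists B^-1, A^-1, c; rewrite A'0 B'0; split=> //; split=> // s s0.
by split; [exact: gbound | rewrite g_der//; split; [exact: odeq | exact: cE]].
Qed.
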